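(* Let $\mathcal{A}$ be a tree-based sorting algorithm (i.e. a BST mergesort or a BT partition sort) which sorts the permutation $\pi$ of $\{1,\dots,n\}$ using $\mathcal{A}(\pi)$ accesses. Then $\mathrm{OPT}_{\mathrm{BST}}(\pi) \in O(\mathcal{A}(\pi))$.
   Context: BST model: the keys $\{1,\dots,n\}$ are stored in a binary search tree (BST). An access sequence $x_1,\dots,x_m$ is served in order; each search starts with a pointer at the root and at each step may move the pointer to the parent, left child or right child, or rotate the current node with its parent, each action at unit cost; the search must visit its key. An offline BST algorithm knows the whole sequence in advance. $\mathrm{OPT}_{\mathrm{BST}}(\pi)$ is the minimum cost of an offline BST algorithm serving the permutation $\pi$ viewed as an access sequence. A top tree of a binary tree $T$ is a connected set of nodes of $T$ containing the root; the subtrees of $T$ hanging off a top tree are the subtrees of $T$ rooted at children (outside $\tau$) of nodes of $\tau$. BST merge: given BSTs $T_A,T_B$ with disjoint keys, for some top trees $\tau_a$ of $T_A$ and $\tau_b$ of $T_B$ it returns a BST $T$ on the union of the keys such that for some top tree $\tau$ of $T$, $\tau=\tau_a\cup\tau_b$ (as key sets), the subtrees hanging off $\tau$ are unchanged subtrees of $T_A$ or $T_B$, and $\tau$ contains all block boundaries; here, listing the merged keys in sorted order, a block is a maximal contiguous run of keys coming from the same input tree, and block boundaries are the first and last keys of each block. Its number of accesses is $|\tau|$. BST mergesort: on an input sequence of size 1 it returns it (as a one-node BST); otherwise it splits the input sequence into two contiguous parts, each of size at least 1, sorts each part recursively by a BST mergesort, and applies a BST merge to the results. Its number of accesses is the sum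 of accesses over all merges. BT partition: given a binary tree (BT) $T$ (not ordered by key; its left-to-right order of keys represents input order), for some top tree $\tau$ of $T$ it returns two nonempty BTs $T_A,T_B$ with distinct keys such that for some top trees $\tau_a$ of $T_A$, $\tau_b$ of $T_B$, $\tau=\tau_a\cup\tau_b$, the other subtrees of $T$ appear unchanged in $T_A$ or $T_B$, $\tau$ contains the block boundaries of the partitioned output (blocks being maximal contiguous runs, in the left-to-right order of $T$, of keys sent to the same output), and the left-to-right orders of keys of $T_A$ and of $T_B$ are subsequences of that of $T$. Its number of accesses is $|\tau|$. BT partition sort: on a BT $T$ of size one it stops; otherwise it BT-partitions $T$ into $T_a,T_b$ such that for some key $k$ all keys of $T_a$ are $<k$ and all keys of $T_b$ are $\ge k$, recurses on both, and appends the results. It sorts $\pi$ when started on a BT whose left-to-right order of keys is $\pi$. Its number of accesses is the sum over all partitions. *)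

(* Defs.v *)
From mathcomp Require Import all_boot.
From Stdlib Require List.
Set Implicit Arguments. Unset Strict Implicit. Unset Printing Implicit Defensive.

Inductive tree : Type :=
| Leaf : tree
| Node : tree -> nat -> tree -> tree.

Fixpoint inorder (t : tree) : seq nat :=
  match t with
  | Leaf => [::]
  | Node l k r => inorder l ++ k :: inorder r
  end.

Fixpoint subtrees (t : tree) : seq tree :=
  match t with
  | Leaf => [::]
  | Node l _ r => t :: (subtrees l ++ subtrees r)
  end.

Fixpoint top_below (S : seq nat) (t : tree) : bool :=
  match t with
  | Leaf => true
  | Node l k r =>
      if k \in S then top_below S l && top_below S r
      else all (fun x => x \notin S) (inorder t)
  end.

Definition root_in (S : seq nat) (t : tree) : bool :=
  match t with Leaf => false | Node _ k _ => k \in S end.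

(* S (a duplicate-free list of keys of T) is a top tree of T:
   a connected set of nodes of T containing the root. *)
Definition is_top (S : seq nat) (T : tree) : bool :=
  [&& root_in S T, top_below S T, uniq S & all (fun x => x \in inorder T) S].

Fixpoint hang (S : seq nat) (t : tree) : seq tree :=
  match t with
  | Leaf => [::]
  | Node l k r => if k \in S then hang S l ++ hang S r else [:: t]
  end.

(* Block boundaries of the sequence s labelled by p: first and last
   elements of each maximal run of consecutive elements with equal label. *)
Definition boundaries (s : seq nat) (p : pred nat) : seq nat :=
  [seq nth 0 s i | i <- iota 0 (size s) &
     [|| i == 0, i.+1 == size s,
         p (nth 0 s i.-1) != p (nth 0 s i) | p (nth 0 s i.+1) != p (nth 0 s i)]].

Definition bst_merge (TA TB T : tree) (cost : nat) : Prop :=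
  sorted ltn (inorder TA) /\ sorted ltn (inorder TB) /\
  ~~ has (fun x => x \in inorder TB) (inorder TA) /\
  sorted ltn (inorder T) /\ perm_eq (inorder T) (inorder TA ++ inorder TB) /\
  exists tau taua taub : seq nat,
    is_top tau T /\ is_top taua TA /\ is_top taub TB /\
    perm_eq tau (taua ++ taub) /\
    (forall t, List.In t (hang tau T) ->
               List.In t (subtrees TA) \/ List.In t (subtrees TB)) /\
    all (fun x => x \in tau)
        (boundaries (sort leq (inorder TA ++ inorder TB))
                    (fun x => x \in inorder TA)) /\
    cost = size tau.

Inductive ms_run : seq nat -> tree -> nat -> Prop :=
| ms_single x : ms_run [:: x] (Node Leaf x Leaf) 0
| ms_split s1 s2 T1 T2 T c1 c2 c :
    s1 <> [::] -> s2 <> [::] ->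
    ms_run s1 T1 c1 -> ms_run s2 T2 c2 -> bst_merge T1 T2 T c ->
    ms_run (s1 ++ s2) T (c1 + c2 + c).

Definition bt_partition (T TA TB : tree) (cost : nat) : Prop :=
  uniq (inorder T) /\ TA <> Leaf /\ TB <> Leaf /\
  perm_eq (inorder T) (inorder TA ++ inorder TB) /\
  subseq (inorder TA) (inorder T) /\ subseq (inorder TB) (inorder T) /\
  exists tau taua taub : seq nat,
    is_top tau T /\ is_top taua TA /\ is_top taub TB /\
    perm_eq tau (taua ++ taub) /\
    (forall t, List.In t (hang tau T) ->
               List.In t (subtrees TA) \/ List.In t (subtrees TB)) /\
    all (fun x => x \in tau)
        (boundaries (inorder T) (fun x => x \in inorder TA)) /\
    cost = size tau.

Inductive ps_run : tree -> nat -> Prop :=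
| ps_single x : ps_run (Node Leaf x Leaf) 0
| ps_step T Ta Tb k c ca cb :
    bt_partition T Ta Tb c ->
    all (fun x => x < k) (inorder Ta) -> all (fun x => k <= x) (inorder Tb) ->
    ps_run Ta ca -> ps_run Tb cb ->
    ps_run T (c + ca + cb).

(* Zipper: a frame records the node we descended from. *)
Inductive frame : Type :=
| FL : nat -> tree -> frame   (* went to left child of node k, whose right subtree is r *)
| FR : tree -> nat -> frame.  (* went to right child of node k, whose left subtree is l *)

Definition state := (seq frame * tree)%type.

Fixpoint plug (c : seq frame) (t : tree) : tree :=
  match c with
  | [::] => t
  | FL k r :: c' => plug c' (Node t k r)
  | FR l k :: c' => plug c' (Node l k t)
  end.

Definition focus_key (s : state) : option nat :=
  match s.2 with Leaf => None | Node _ k _ => Some k end.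

Inductive bst_step : state -> state -> Prop :=
| st_left c l k r : l <> Leaf -> bst_step (c, Node l k r) (FL k r :: c, l)
| st_right c l k r : r <> Leaf -> bst_step (c, Node l k r) (FR l k :: c, r)
| st_up_l c k r t : bst_step (FL k r :: c, t) (c, Node t k r)
| st_up_r c l k t : bst_step (FR l k :: c, t) (c, Node l k t)
| st_rot_l c a x b y z :
    bst_step (FL y z :: c, Node a x b) (c, Node a x (Node b y z))
| st_rot_r c a y b x z :
    bst_step (FR a y :: c, Node b x z) (c, Node (Node a y b) x z).

Inductive search_run (x : nat) : state -> state -> nat -> bool -> Prop :=
| sr_here s : search_run x s s 0 (focus_key s == Some x)
| sr_move s s1 s' k v :
    bst_step s s1 -> search_run x s1 s' k v ->
    search_run x s s' k.+1 (v || (focus_key s == Some x)).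

Inductive serve : tree -> seq nat -> nat -> Prop :=
| serve_nil T : serve T [::] 0
| serve_cons T x xs s' k T' c :
    search_run x ([::], T) s' k true -> T' = plug s'.1 s'.2 ->
    serve T' xs c -> serve T (x :: xs) (k + c).

Definition OPT_BST_le (pi : seq nat) (b : nat) : Prop :=
  exists (T0 : tree) (c : nat),
    inorder T0 = iota 1 (size pi) /\ serve T0 pi c /\ c <= b.

(* Main.v *)
Require Import Defs.
From mathcomp Require Import all_boot zify.
From Stdlib Require List.
Set Implicit Arguments. Unset Strict Implicit. Unset Printing Implicit Defensive.

(* Put the keys on one axis and time on the other, and call a set of points
   satisfied if any two of its points that share no coordinate span a rectangle
   containing a third one.  A satisfied set with a point in every row is
   executed by a search tree at a cost linear in its size (Demaine, Harmon,
   Iacono, Kane and Patrascu): keep the tree heap-ordered by the next touch; the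
   keys touched now form a top tree, which is rearranged according to their new
   next touches, and satisfaction says exactly that the subtrees hanging off it
   remain below their new parents.
   Conversely a mergesort run yields such a set: when the results for the time
   intervals [a, m) and [m, b) are merged, touch the keys of the top tree at the
   four times a, m - 1, m and b - 1.  A partition sort read backwards is a
   mergesort with keys and positions exchanged, and satisfaction is symmetric
   under exchanging the axes. *)

(** * Pointer walks *)

(* The index only bounds the number of steps. *)
Inductive walk : state -> state -> nat -> Prop :=
| walk_refl s k : walk s s k
| walk_step s s1 s' k : bst_step s s1 -> walk s1 s' k -> walk s s' k.+1.

Lemma walk_le s s' k k' : walk s s' k -> k <= k' -> walk s s' k'.
Proof.
move=> H; elim: H k' => [s0 k0|s0 s1 s2 k0 st _ IH] [|k'] // le; try by constructor.
exact: walk_step st (IH _ le).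
Qed.

Lemma walk_trans s1 s2 s3 k1 k2 :
  walk s1 s2 k1 -> walk s2 s3 k2 -> walk s1 s3 (k1 + k2).
Proof.
elim=> [s k|s s' s'' k st _ IH] H2; first exact: walk_le H2 (leq_addl _ _).
by rewrite addSn; apply: walk_step st (IH H2).
Qed.

Lemma walk_search x s s' k :
  walk s s' k -> exists k' v, [/\ search_run x s s' k' v, k' <= k &
                                 focus_key s = Some x -> v].
Proof.
elim=> [s0 k0|s0 s1 s2 k0 st _ [k' [v [H le _]]]].
  by exists 0, (focus_key s0 == Some x); split=> // [|->]; [constructor | rewrite eqxx].
exists k'.+1, (v || (focus_key s0 == Some x)); split=> // [|->].
  exact: sr_move st H.
by rewrite eqxx orbT.
Qed.

Lemma walk_visit x s s1 s2 k1 k2 :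
  walk s s1 k1 -> walk s1 s2 k2 -> focus_key s1 = Some x ->
  exists2 k, search_run x s s2 k true & k <= k1 + k2.
Proof.
move=> H1 H2; elim: H1 H2 => [s0 k0|s0 s0' s' k st _ IH] H2 fx.
  have [k' [v [H le /(_ fx) vT]]] := walk_search x H2.
  by exists k'; [rewrite vT in H | lia].
have [k' H le] := IH H2 fx.
exists k'.+1; last by lia.
by rewrite -[true]/(true || (focus_key s0 == Some x)); apply: sr_move st H.
Qed.

(** Rotations are reversible, and both directions are used: the old top tree is flattened, and the
    flattening of the new one is run backwards. *)
Definition biwalk k s s' := walk s s' k /\ walk s' s k.

Lemma biwalk_refl k s : biwalk k s s.
Proof. by split; constructor. Qed.

Lemma biwalk_trans s1 s2 s3 k1 k2 k :
  biwalk k1 s1 s2 -> biwalk k2 s2 s3 -> k1 + k2 <= k -> biwalk k s1 s3.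
Proof.
move=> [a b] [a' b'] le; split; first exact: walk_le (walk_trans a a') le.
by apply: walk_le (walk_trans b' b) _; rewrite addnC.
Qed.

Lemma biwalk_rot c a x b y z :
  biwalk 2 (c, Node (Node a x b) y z) (c, Node a x (Node b y z)).
Proof.
split.
  by apply: walk_step (st_left _ _ _ _) _ => //; apply: walk_step (st_rot_l _ _ _ _ _ _) _; constructor.
by apply: walk_step (st_right _ _ _ _) _ => //; apply: walk_step (st_rot_r _ _ _ _ _ _) _; constructor.
Qed.

Lemma walk_right n c l x t t' :
  t <> Leaf -> walk (FR l x :: c, t) (FR l x :: c, t') n ->
  walk (c, Node l x t) (c, Node l x t') n.+2.
Proof.
move=> tN H; apply: walk_step (st_right _ _ _ tN) _.
rewrite -addn1; apply: walk_trans H _.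
by apply: walk_step (st_up_r _ _ _ _) _; constructor.
Qed.

Lemma biwalk_right n c l x t t' :
  t <> Leaf -> t' <> Leaf -> biwalk n (FR l x :: c, t) (FR l x :: c, t') ->
  biwalk n.+2 (c, Node l x t) (c, Node l x t').
Proof. by move=> tN tN' [a b]; split; apply: walk_right. Qed.

(** * Flattening a top tree by rotations *)

(* The top tree of [U] formed by the keys in [Y], flattened: a list of pairs
   (subtree hanging in the gap before the key, key), and the last subtree. *)
Fixpoint dec (Y : pred nat) (U : tree) : seq (tree * nat) * tree :=
  match U with
  | Leaf => ([::], Leaf)
  | Node l k r =>
      if Y k then ((dec Y l).1 ++ ((dec Y l).2, k) :: (dec Y r).1, (dec Y r).2)
      else ([::], U)
  end.

(* The right-leaning tree with a given decomposition, a canonical form reached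
   from every tree by rotations inside the top tree. *)
Definition comb (p : seq (tree * nat)) (C : tree) :=
  foldr (fun hk D => Node hk.1 hk.2 D) C p.

Lemma comb_cat p q C : comb (p ++ q) C = comb p (comb q C).
Proof. exact: foldr_cat. Qed.

Lemma comb_Node p l k r : comb p (Node l k r) <> Leaf.
Proof. by case: p. Qed.

(** One rotation lifts the root of [U] onto the right spine; then its right and left parts are
    flattened in turn. Each key pays 2 for its own rotation and 2 for stepping past it down the
    spine and back. *)
Lemma biwalk_comb_left Y U c k C :
  biwalk (4 * size (dec Y U).1) (c, Node U k C)
         (c, comb (dec Y U).1 (Node (dec Y U).2 k C)).
Proof.
elim: U c k C => [|l IHl x r IHr] c k C /=; first exact: biwalk_refl.
case: (Y x) => /=; last exact: biwalk_refl.
apply: biwalk_trans (biwalk_rot _ _ _ _ _ _) _ (_ : 2 + (4 * size (dec Y r).1 + 2 + 4 * size (dec Y l).1) <= _); last by rewrite size_cat /=; lia.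
apply: biwalk_trans (leqnn _); last first.
  by rewrite comb_cat; apply: IHl.
rewrite addn2; apply: biwalk_right => //; exact: comb_Node.
Qed.

Lemma biwalk_comb Y U c :
  biwalk (4 * size (dec Y U).1) (c, U) (c, comb (dec Y U).1 (dec Y U).2).
Proof.
elim: U c => [|l _ x r IHr] c /=; first exact: biwalk_refl.
case Yx: (Y x) => /=; last exact: biwalk_refl.
apply: (@biwalk_trans _ (c, Node l x (comb (dec Y r).1 (dec Y r).2)) _ (4 * size (dec Y r).1 + 2) (4 * size (dec Y l).1)); last by rewrite size_cat /=; lia.
  case: r IHr => [|r1 y r2] IHr /=; first exact: biwalk_refl.
  rewrite addn2; apply: biwalk_right (IHr _) => //=.
  by case: (Y y) => //=; case: (dec Y r1).1.
rewrite comb_cat; exact: biwalk_comb_left.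
Qed.

Definition dkeys (p : seq (tree * nat)) := [seq hk.2 | hk <- p].
Definition dhang (D : seq (tree * nat) * tree) :=
  flatten [seq inorder hk.1 | hk <- D.1] ++ inorder D.2.

Lemma inorder_comb p C :
  inorder (comb p C) = flatten [seq rcons (inorder hk.1) hk.2 | hk <- p] ++ inorder C.
Proof. by elim: p => //= hk p ->; rewrite cat_rcons -catA. Qed.

Lemma inorder_dec Y U : inorder (comb (dec Y U).1 (dec Y U).2) = inorder U.
Proof.
elim: U => //= l IHl k r IHr; case: (Y k) => //=.
by rewrite comb_cat inorder_comb /= IHr -IHl inorder_comb -catA.
Qed.

Lemma walk_to_top Y U x c :
  x \in dkeys (dec Y U).1 ->
  exists s, [/\ walk (c, U) s (size (dec Y U).1), walk s (c, U) (size (dec Y U).1)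
             & focus_key s = Some x].
Proof.
elim: U c => [|l IHl k r IHr] c //=; case: (Y k) => //=.
rewrite /dkeys map_cat mem_cat /= in_cons => /or3P[xl|/eqP->|xr].
- have [s [a b f]] := IHl (FL k r :: c) xl.
  have lN : l <> Leaf by case: (l) xl.
  exists s; split=> //.
    by apply: walk_le (walk_step (st_left _ _ _ lN) a) _; rewrite size_cat /=; lia.
  apply: walk_le (walk_trans b (walk_step (st_up_l _ _ _ _) (walk_refl _ 0))) _.
  by rewrite size_cat /=; lia.
- by exists (c, Node l k r); split=> //; constructor.
- have [s [a b f]] := IHr (FR l k :: c) xr.
  have rN : r <> Leaf by case: (r) xr.
  exists s; split=> //.
    by apply: walk_le (walk_step (st_right _ _ _ rN) a) _; rewrite size_cat /=; lia.
  apply: walk_le (walk_trans b (walk_step (st_up_r _ _ _ _) (walk_refl _ 0))) _.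
  by rewrite size_cat /=; lia.
Qed.

(** * Trees heap-ordered by next touch *)
Fixpoint heap (f : nat -> nat) (t : tree) : bool :=
  match t with
  | Leaf => true
  | Node l k r =>
      [&& all (fun x => f k <= f x) (inorder l ++ inorder r), heap f l & heap f r]
  end.

Definition root_out (Y : pred nat) (t : tree) : bool :=
  match t with Leaf => true | Node _ k _ => ~~ Y k end.

Lemma eq_in_heap f g t : {in inorder t, f =1 g} -> heap f t = heap g t.
Proof.
elim: t => //= l IHl k r IHr fg.
have fgl : {in inorder l, f =1 g} by move=> x xl; apply: fg; rewrite mem_cat xl.
have fgr : {in inorder r, f =1 g}.
  by move=> x xr; apply: fg; rewrite mem_cat inE xr !orbT.
rewrite (IHl fgl) (IHr fgr); congr (_ && _); apply: eq_in_all => x.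
rewrite mem_cat => xlr; rewrite !fg // mem_cat inE ?eqxx ?orbT //.
by case/orP: xlr => ->; rewrite ?orbT.
Qed.

Lemma argmin_split (A : Type) (g : A -> nat) (p : seq A) :
  0 < size p ->
  exists p1 a p2, p = p1 ++ a :: p2 /\ all (fun b => g a <= g b) p.
Proof.
elim: p => // a [|b p] IH _; first by exists [::], a, [::] => /=; rewrite leqnn.
have [//|p1 [c [p2 [e le]]]] := IH.
case: (leqP (g a) (g c)) => ac.
  exists [::], a, (b :: p); split=> //.
  rewrite [all _ _]/= leqnn /=; apply: sub_all le => x; exact: leq_trans.
by exists (a :: p1), c, p2; rewrite e; split=> //; rewrite -e [all _ _]/= (ltnW ac).
Qed.

Lemma mem_comb p h x :
  (x \in inorder (comb p h)) = (x \in dkeys p) || (x \in dhang (p, h)).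
Proof.
elim: p => //= -[g k] p IH /=; rewrite /dhang /= !mem_cat !in_cons IH /dhang mem_cat.
case: (x \in inorder g); rewrite ?orbT //=.
by case: (x == k).
Qed.

Lemma inorder_comb_split p1 h1 k p2 h :
  inorder (comb (p1 ++ (h1, k) :: p2) h) =
  inorder (comb p1 h1) ++ k :: inorder (comb p2 h).
Proof. by rewrite comb_cat !inorder_comb /= cat_rcons -!catA. Qed.

Lemma sorted_split (pos : nat -> nat) (s1 s2 : seq nat) k :
  sorted (relpre pos ltn) (s1 ++ k :: s2) ->
  [/\ sorted (relpre pos ltn) s1, sorted (relpre pos ltn) s2,
      {in s1, forall x, pos x < pos k} & {in s2, forall x, pos k < pos x}].
Proof.
have tr : transitive (relpre pos ltn) by move=> y x z; apply: ltn_trans.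
rewrite !(sorted_pairwise tr) pairwise_cat /= => /and4P[/allrelP a -> /allP b ->].
by split=> // x xs; apply: a; rewrite ?mem_head.
Qed.

(** The treap construction: a key of [p] with least [f] becomes the root, and both sides recurse.
    The last hypothesis compares a hanging key only with the keys of [p] next to it, which suffices
    because the root is at most any of these. *)
Lemma heap_rebuild (f : nat -> nat) (Y : pred nat) p h :
  sorted ltn (inorder (comb p h)) ->
  all Y (dkeys p) ->
  all (fun hk => heap f hk.1 && root_out Y hk.1) p -> heap f h -> root_out Y h ->
  (forall x y, y \in dkeys p -> x \in dhang (p, h) ->
     (forall z, z \in dkeys p -> ~~ ((x < z < y) || (y < z < x))) -> f y <= f x) ->
  exists2 U, dec Y U = (p, h) & heap f U.
Proof.
elim: {p}(size p) {-2}p (leqnn (size p)) h => [|n IH] p.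
  case: p => // _ h _ _ _ hh rh _; exists h => //.
  by case: h hh rh => //= l k r _ /negbTE ->.
move=> szp h sp Yp hp hh rh cnd.
case: (posnP (size p)) => [/size0nil p0|p_gt0].
  rewrite {}p0; exists h => //.
  by case: h sp hh rh cnd => //= l k r _ _ /negbTE ->.
have [p1 [[h1 k] [p2 [e min]]]] := argmin_split (fun hk => f hk.2) p_gt0.
have mink y : y \in dkeys p -> f k <= f y.
  by move: min; rewrite -(all_map snd (fun y => f k <= f y)) => /allP; apply.
have minx x : x \in inorder (comb p h) -> f k <= f x.
  rewrite mem_comb => /orP[/mink //|xh].
  have szk : 0 < size (dkeys p) by rewrite size_map.
  (* [y] is a key of [p] nearest to [x]: with truncated subtraction the sum is the distance. Hence
     no key of [p] lies strictly between them. *)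
  have [q1 [y [q2 [ey /allP near]]]] :=
    argmin_split (fun z => (x - z) + (z - x)) szk.
  have yp : y \in dkeys p by rewrite ey mem_cat inE eqxx orbT.
  apply: leq_trans (mink _ yp) (cnd _ _ yp xh _) => z /near /=; clear; lia.
move: sp; rewrite e inorder_comb_split => /(@sorted_split id)[s1 s2 lt1 lt2].
move: Yp hp; rewrite e /dkeys map_cat !all_cat /= => /and3P[Y1 Yk Y2].
move=> /and3P[o1 /andP[ho1 ro1] o2].
have sz12 : size p1 <= n /\ size p2 <= n by move: szp; rewrite e size_cat /=; clear; lia.
have keyE z : z \in dkeys p = [|| z \in dkeys p1, z == k | z \in dkeys p2].
  by rewrite e /dkeys map_cat mem_cat in_cons.
have hangE z : z \in dhang (p, h) = (z \in dhang (p1, h1)) || (z \in dhang (p2, h)).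
  by rewrite e /dhang /= map_cat flatten_cat /= !mem_cat -!orbA.
have [] := IH p1 sz12.1 h1 => //.
  move=> x y yp xh out; apply: cnd; rewrite ?keyE ?hangE ?yp ?xh // => z.
  have := lt1 x; have := lt1 y; rewrite !mem_comb xh yp orbT => /(_ isT) yk /(_ isT) xk.
  rewrite keyE => /or3P[/out //|/eqP->|zp]; first by clear -xk yk; lia.
  by have := lt2 z; rewrite mem_comb zp => /(_ isT); clear -xk yk; lia.
move=> U1 d1 hp1.
have [] := IH p2 sz12.2 h => //.
  move=> x y yp xh out; apply: cnd; rewrite ?keyE ?hangE ?yp ?xh ?orbT // => z.
  have := lt2 x; have := lt2 y; rewrite !mem_comb xh yp orbT => /(_ isT) yk /(_ isT) xk.
  rewrite keyE => /or3P[zp|/eqP->|/out //]; last by clear -xk yk; lia.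
  by have := lt1 z; rewrite mem_comb zp => /(_ isT); clear -xk yk; lia.
move=> U2 d2 hp2.
exists (Node U1 k U2); first by rewrite /= Yk d1 d2.
rewrite /= hp1 hp2 !andbT; apply/allP => x.
rewrite -(inorder_dec Y U1) -(inorder_dec Y U2) d1 d2 mem_cat => xin.
apply: minx; rewrite e inorder_comb_split mem_cat in_cons.
by case/orP: xin => ->; rewrite ?orbT.
Qed.

(** The case of [heap_rebuild] in which every key belongs to the top tree and nothing hangs off
    it. *)
Lemma heap_exists f s : sorted ltn s -> exists2 U, inorder U = s & heap f U.
Proof.
move=> ss; pose p := [seq (Leaf, x) | x <- s].
have e : inorder (comb p Leaf) = s.
  by rewrite inorder_comb /= cats0 /p -map_comp; elim: (s) => //= x s' ->.
have nohang : dhang (p, Leaf) = [::].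
  by rewrite /dhang /= cats0 /p -map_comp; elim: (s).
have [] := @heap_rebuild f predT p Leaf; rewrite ?e ?all_predT ?nohang //.
  by rewrite /p all_map; apply/allP.
by move=> U d hU; exists U => //; rewrite -(inorder_dec predT U) d.
Qed.

Lemma dec_hangers f Y U :
  heap f U ->
  all (fun hk => heap f hk.1 && root_out Y hk.1) (dec Y U).1 /\
  heap f (dec Y U).2 && root_out Y (dec Y U).2.
Proof.
elim: U => //= l IHl k r IHr /and3P[a hl hr].
case Yk: (Y k) => /=; last by rewrite a hl hr Yk.
have [l1 l2] := IHl hl; have [r1 r2] := IHr hr.
by rewrite all_cat /= l1 l2 r1.
Qed.

(** Below a key whose value exceeds the lower bound [t], heap order keeps all values above [t]. So
    the keys of value [t] are closed under ancestors, and the decomposition catches all of them. *)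
Lemma dec_top f (Y : pred nat) t U :
  heap f U -> {in inorder U, forall x, (t <= f x) && (Y x == (f x == t))} ->
  {in dhang (dec Y U), forall x, ~~ Y x}.
Proof.
elim: U => //= l IHl k r IHr /and3P[a hl hr] H.
have Hl : {in inorder l, forall x, (t <= f x) && (Y x == (f x == t))}.
  by move=> x xl; apply: H; rewrite mem_cat xl.
have Hr : {in inorder r, forall x, (t <= f x) && (Y x == (f x == t))}.
  by move=> x xr; apply: H; rewrite mem_cat inE xr !orbT.
case Yk: (Y k) => x /=.
  have -> : dhang ((dec Y l).1 ++ ((dec Y l).2, k) :: (dec Y r).1, (dec Y r).2)
            = dhang (dec Y l) ++ dhang (dec Y r).
    by rewrite /dhang /= map_cat flatten_cat /= -!catA.
  by rewrite mem_cat => /orP[/(IHl hl Hl)|/(IHr hr Hr)].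
rewrite /dhang /= => xin.
have kx : f k <= f x.
  move: xin; rewrite mem_cat in_cons orbCA => /orP[/eqP-> //|].
  by rewrite -mem_cat => /(allP a).
have := H k; rewrite mem_cat mem_head orbT Yk => /(_ isT) /andP[tk /eqP tk'].
have /andP[_ /eqP->] := H x xin; lia.
Qed.

(** * Executing a satisfied set *)
Definition btw (a b c : nat) := (a <= b <= c) || (c <= b <= a).

Definition satisfied (Q : seq (nat * nat)) :=
  forall p q, p \in Q -> q \in Q -> p.1 <> q.1 -> p.2 <> q.2 ->
  exists r, [/\ r \in Q, r <> p, r <> q, btw p.1 r.1 q.1 & btw p.2 r.2 q.2].

(* Equal to [m] when [x] is not touched at any time in [t, m). *)
Definition next_touch (Q : seq (nat * nat)) m t x :=
  find (fun s => (t <= s) && ((x, s) \in Q)) (iota 0 m).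

Section NextTouch.
Variables (Q : seq (nat * nat)) (m : nat).
Implicit Types (t x y s : nat).

Lemma next_touch_le t x : next_touch Q m t x <= m.
Proof. by rewrite -[leqRHS](size_iota 0) find_size. Qed.

Lemma next_touchP t x :
  next_touch Q m t x < m -> t <= next_touch Q m t x /\ (x, next_touch Q m t x) \in Q.
Proof.
move=> lt.
have h : has (fun s => (t <= s) && ((x, s) \in Q)) (iota 0 m).
  by rewrite has_find size_iota.
by move/(nth_find 0): h; rewrite nth_iota // => /andP[].
Qed.

Lemma next_touch_min t x s : t <= s -> (x, s) \in Q -> next_touch Q m t x <= s.
Proof.
move=> ts xs; case: (leqP m s) => [|sm]; first exact: leq_trans (next_touch_le _ _).
rewrite leqNgt; apply/negP => /(before_find 0).
by rewrite nth_iota // add0n ts xs.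
Qed.

Lemma next_touch_ge t x : t <= m -> t <= next_touch Q m t x.
Proof.
move=> tm; case: (ltnP (next_touch Q m t x) m) => [/next_touchP[]//|].
exact: leq_trans.
Qed.

Lemma next_touch_eq t x : t < m -> ((x, t) \in Q) = (next_touch Q m t x == t).
Proof.
move=> tm; apply/idP/eqP => [xt|e].
  by apply/eqP; rewrite eqn_leq next_touch_min ?next_touch_ge // ltnW.
by have [] := @next_touchP t x; rewrite e.
Qed.

Lemma next_touchS t x :
  (x, t) \notin Q -> next_touch Q m t.+1 x = next_touch Q m t x.
Proof.
move=> xt; apply: eq_find => s; case: (ltngtP t s) => //= e.
by rewrite -e (negbTE xt).
Qed.

Hypothesis satQ : satisfied Q.

(** Otherwise [x] is touched at a time [s] before [y] is touched again. A third point in the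
    rectangle of [(y, t)] and [(x, s)] avoids column [y], untouched after [t] up to [s], and row
    [t], untouched at [x] and strictly between. With [(y, t)] it spans a smaller rectangle of the
    same kind, without end. *)
Lemma next_touch_near t x y :
  (y, t) \in Q -> (x, t) \notin Q ->
  (forall z, (x < z < y) || (y < z < x) -> (z, t) \notin Q) ->
  next_touch Q m t.+1 y <= next_touch Q m t.+1 x.
Proof.
move=> yt xt out; rewrite leqNgt; apply/negP => lt.
set s := next_touch _ _ _ x in lt.
have [ts xs] : t < s /\ (x, s) \in Q.
  by apply: next_touchP; apply: leq_trans lt (next_touch_le _ _).
have ny s' : t < s' -> s' <= s -> (y, s') \notin Q.
  by move=> l1 l2; apply/negP => /(next_touch_min l1); clear -lt l2; lia.
have yx : x <> y by move=> e; move: xt; rewrite e yt.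
(* Descent on the distance to (y, t) among the points of Q in the rectangle
   spanned by (y, t) and (x, s), off row t. *)
suff absurd N x' s' : (x' - y) + (y - x') + s' < N -> btw y x' x -> x' <> y ->
    t < s' -> s' <= s -> (x', s') \in Q -> False.
  by apply: (absurd _ x s (leqnn _)) => //; clear; rewrite /btw; lia.
elim: N x' s' => // N IH x' s' szN b1 x'y ts' s's x's'.
have [||[x2 s2] /= [x2Q ne1 ne2 b2 b3]] := satQ yt x's' => /=.
- exact: nesym.
- by clear -ts'; lia.
have s2le : t <= s2 <= s' by clear -b3 ts'; move: b3; rewrite /btw; lia.
have btx : btw y x2 x by clear -b1 b2; move: b1 b2; rewrite /btw; lia.
have [e|ne] := eqVneq x2 y.
  have s2t : s2 <> t by move=> e2; apply: ne1; rewrite e e2.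
  by move: x2Q; apply/negP; rewrite e; apply: ny; clear -s2t s2le s's; lia.
have [e|ne'] := eqVneq s2 t.
  have x2x : x2 <> x by move=> e2; move: xt; rewrite -e -e2 x2Q.
  move: x2Q; apply/negP; rewrite e; apply: out.
  by clear -btx ne x2x; move: btx; rewrite /btw; lia.
apply: (IH x2 s2) => //; last 3 first.
- exact/eqP.
- by clear -s2le ne'; lia.
- by clear -s2le s's; lia.
suff : (x2 != x') || (s2 != s').
  by clear -szN b1 x'y b2 s2le; move: b2 b1; rewrite /btw; lia.
by rewrite -negb_and; apply/negP => /andP[/eqP e1 /eqP e2]; apply: ne2; rewrite e1 e2.
Qed.

End NextTouch.

Lemma dkeys_touched Y U : {in dkeys (dec Y U).1, forall x, Y x && (x \in inorder U)}.
Proof.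
elim: U => //= l IHl k r IHr x; case Yk: (Y k) => //=.
rewrite /dkeys map_cat !mem_cat !inE => /or3P[/IHl/andP[->->]|/eqP->|/IHr/andP[->->]] //.
  by rewrite Yk eqxx orbT.
by rewrite !orbT.
Qed.

Lemma subseq_dkeys p h : subseq (dkeys p) (inorder (comb p h)).
Proof.
elim: p => [|[g k] p IH] /=; first exact: sub0seq.
rewrite -[k :: _]cat0s; apply: cat_subseq; first exact: sub0seq.
by rewrite /= eqxx.
Qed.

(** By [dec_top] the touched keys form a top tree; [heap_rebuild] rearranges it by the touches after
    [t], its condition being [next_touch_near]. The old and new trees share one flattening, through
    which the rotations pass. *)
Lemma serve_row Q pi t U n :
  satisfied Q -> t < size pi -> inorder U = iota 1 n ->
  nth 0 pi t \in iota 1 n -> (nth 0 pi t, t) \in Q ->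
  heap (next_touch Q (size pi) t) U ->
  exists U' k, [/\ search_run (nth 0 pi t) ([::], U) ([::], U') k true,
    k <= 10 * count (fun q => q.2 == t) Q, inorder U' = iota 1 n &
    heap (next_touch Q (size pi) t.+1) U'].
Proof.
move=> satQ tm inU piU piQ hU; set x := nth 0 pi t in piU piQ *.
pose Y y := (y, t) \in Q; set m := size pi in tm hU *.
have sU : sorted ltn (inorder U) by rewrite inU iota_ltn_sorted.
have topY : {in dhang (dec Y U), forall y, ~~ Y y}.
  apply: (@dec_top (next_touch Q m t) Y t) => // y _.
  by rewrite next_touch_ge 1?ltnW // /Y (next_touch_eq _ _ tm) eqxx.
have keyY := @dkeys_touched Y U.
have eqh h : {subset inorder h <= dhang (dec Y U)} ->
    heap (next_touch Q m t) h = heap (next_touch Q m t.+1) h.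
  by move=> sub; apply: eq_in_heap => y /sub /topY yn; rewrite next_touchS.
have [hp /andP[hh rh]] := dec_hangers Y hU.
case E: (dec Y U) topY keyY eqh hp hh rh => [p h] topY keyY eqh hp hh rh.
have inp : inorder (comb p h) = inorder U by rewrite -(inorder_dec Y U) E.
have memU y : (y \in inorder U) = (y \in dkeys p) || (y \in dhang (p, h)).
  by rewrite -mem_comb inp.
have xp : x \in dkeys p.
  move: piU; rewrite -inU memU => /orP[//|/topY]; by rewrite /Y piQ.
have [] := @heap_rebuild (next_touch Q m t.+1) Y p h; rewrite ?inp //.
- by apply/allP => y /keyY /andP[].
- have : forall hk, List.In hk p -> {subset inorder hk.1 <= dhang (p, h)}.
    move=> hk; rewrite /dhang /= => hkp y yh; rewrite mem_cat; apply/orP; left.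
    elim: (p) hkp => //= a q IH [->|/IH]; rewrite mem_cat ?yh //.
    by move=> ->; rewrite orbT.
  move: (dhang (p, h)) eqh => D eqD; elim: (p) hp => //= a q IH /andP[/andP[ha ra] hq] sub.
  rewrite -(eqD _ (sub a (or_introl erefl))) ha ra /=.
  by apply: IH hq _ => hk hkq; apply: sub; right.
- by rewrite -eqh // => y; rewrite /dhang mem_cat /= => ->; exact: orbT.
- move=> z y yp zh out; apply: next_touch_near => //; first by have /andP[] := keyY _ yp.
    exact: topY.
  (* [Q] may touch numbers that are not keys, but [w] lies between two keys and the keys form an
     interval. *)
  move=> w bw; apply/negP => wQ; have : w \in inorder U.
    have : (z \in inorder U) && (y \in inorder U) by rewrite !memU yp zh orbT.
    by rewrite inU !mem_iota; clear -bw; lia.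
  rewrite memU => /orP[/out|/topY]; first by rewrite bw.
  by rewrite /Y wQ.
move=> U' d' hU'.
have [s [w1 w1' fx]] : exists s, [/\ walk ([::], U) s (size p), walk s ([::], U) (size p)
    & focus_key s = Some x].
  by have := @walk_to_top Y U x [::]; rewrite E; apply.
have := biwalk_comb Y U [::]; have := biwalk_comb Y U' [::]; rewrite E d' /=.
move=> [_ w3] [w2 _].
(* To [x] and back, down to the flattening and up to [U']: 1 + 1 + 4 + 4 = 10 steps per touched
   key. *)
have [k run le] := walk_visit w1 (walk_trans w1' (walk_trans w2 w3)) fx.
exists U', k; split=> //; last by rewrite -inU -inp -(inorder_dec Y U') d'.
apply: leq_trans le _.
apply: (@leq_trans (10 * size p)); first by clear; lia.
rewrite leq_mul2l /=.
rewrite -size_filter -(size_map snd p) -(size_map fst (filter _ _)).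
apply: uniq_leq_size.
  apply: (subseq_uniq (subseq_dkeys p h)).
  by rewrite inp inU iota_uniq.
move=> y yp; apply/mapP; exists (y, t) => //; rewrite mem_filter eqxx /=.
by have /andP[] := keyY _ yp.
Qed.

(** The initial tree is free to choose, so it starts heap-ordered for time 0; afterwards each access
    is paid for by the points of its own row. *)
Lemma satisfied_serve Q n pi :
  satisfied Q -> perm_eq pi (iota 1 n) ->
  (forall t, t < n -> (nth 0 pi t, t) \in Q) ->
  OPT_BST_le pi (10 * size Q).
Proof.
move=> satQ pin piQ; have szn : size pi = n by rewrite (perm_size pin) size_iota.
have [U0 inU0 hU0] := @heap_exists (next_touch Q n 0) (iota 1 n) (iota_ltn_sorted _ _).
suff serve_from r t U : r + t = n -> inorder U = iota 1 n ->
    heap (next_touch Q n t) U ->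
    exists2 c, serve U (drop t pi) c & c <= 10 * count (fun q => t <= q.2) Q.
  have [c run le] := serve_from n 0 U0 (addn0 n) inU0 hU0.
  exists U0, c; rewrite szn; split=> //; rewrite drop0 in run; split=> //.
elim: r t U => [|r IH] t U rt inU hU.
  by rewrite drop_oversize ?szn -?rt //; exists 0; first constructor.
have tn : t < n by rewrite -rt addSn ltnS leq_addl.
have tn' : t < size pi by rewrite szn.
have piU : nth 0 pi t \in iota 1 n by rewrite -(perm_mem pin) mem_nth.
rewrite -szn in hU.
have [U' [k [run kle inU' hU']]] := serve_row satQ tn' inU piU (piQ t tn) hU.
rewrite szn in hU'.
have [|c run' cle] := IH t.+1 U' _ inU' hU'; first by rewrite addnS -rt.
exists (k + c); first by rewrite (drop_nth 0 tn'); apply: serve_cons run _ run'.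
have -> : count (fun q => t <= q.2) Q =
          count (fun q => q.2 == t) Q + count (fun q => t < q.2) Q.
  elim: (Q) => //= q Q' ->; case: (ltngtP t q.2) => _ /=; clear; lia.
by rewrite mulnDr leq_add.
Qed.

(** * Ancestors, hanging subtrees and block boundaries *)
(* Proper ancestors. *)
Fixpoint anc (T : tree) (x y : nat) : bool :=
  match T with
  | Leaf => false
  | Node l k r => [|| (x == k) && (y \in inorder l ++ inorder r), anc l x y | anc r x y]
  end.

Lemma anc_inorder T x y : anc T x y -> (x \in inorder T) && (y \in inorder T).
Proof.
elim: T => //= l IHl k r IHr; rewrite !mem_cat !inE.
case/or3P=> [/andP[/eqP-> /orP[]->]|/IHl/andP[->->]|/IHr/andP[->->]] //;
  by rewrite ?eqxx !orbT.
Qed.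

Lemma top_anc S T x y : top_below S T -> anc T x y -> y \in S -> x \in S.
Proof.
elim: T => //= l IHl k r IHr; case: ifP => [kS /andP[tl tr]|_ out].
  by case/or3P=> [/andP[/eqP->]|/(IHl tl)|/(IHr tr)].
move=> xy yS; have : y \in inorder (Node l k r).
  by have /andP[] := @anc_inorder (Node l k r) x y xy.
by move/(allP out); rewrite yS.
Qed.

Lemma hang_anc S T x y :
  anc T x y -> x \notin S -> exists2 h, List.In h (hang S T) & anc h x y.
Proof.
elim: T => //= l IHl k r IHr; case: ifP => [kS|_] xy xS; last first.
  by exists (Node l k r) => //; left.
case/or3P: xy => [/andP[/eqP e]|xy|xy]; first by rewrite e kS in xS.
  by have [h hl hxy] := IHl xy xS; exists h => //; apply/List.in_or_app; left.
by have [h hr hxy] := IHr xy xS; exists h => //; apply/List.in_or_app; right.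
Qed.

Lemma subtrees_anc T h x y : List.In h (subtrees T) -> anc h x y -> anc T x y.
Proof.
elim: T => //= l IHl k r IHr [<- //|/(@List.in_app_or _ _ _ _)[]] hin xy.
  by rewrite (IHl hin xy) orbT.
by rewrite (IHr hin xy) !orbT.
Qed.

Lemma anc_neq T x y : uniq (inorder T) -> anc T x y -> x <> y.
Proof.
elim: T => //= l IHl k r IHr; rewrite uniq_catC /= mem_cat cat_uniq.
case/and3P=> kn ur /andP[_ ul].
case/or3P=> [/andP[/eqP-> yn] e|/(IHl ul)//|/(IHr ur)//].
by move: kn; rewrite -mem_cat; case/negP; rewrite mem_cat orbC -mem_cat e.
Qed.

(** Descend to the node where [x] and [y] part: it is one of them, or their lowest common ancestor,
    which separates them in the order of [T]. *)
Lemma common_anc pos T x y :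
  sorted (relpre pos ltn) (inorder T) -> x \in inorder T -> y \in inorder T -> x <> y ->
  [\/ anc T x y, anc T y x |
      exists2 z, anc T z x && anc T z y & btw (pos x) (pos z) (pos y)].
Proof.
elim: T => //= l IHl k r IHr /sorted_split[sl sr ltl ltr].
rewrite !mem_cat !inE => xT yT xy.
case/or3P: xT => [xl|/eqP xk|xr]; case/or3P: yT => [yl|/eqP yk|yr].
- have [->|->|[z /andP[zx zy] b]] := IHl sl xl yl xy; rewrite ?orbT.
  + by constructor 1. + by constructor 2.
  by constructor 3; exists z; rewrite // zx zy !orbT.
- by constructor 2; rewrite yk eqxx xl.
- constructor 3; exists k; first by rewrite eqxx xl yr !orbT.
  by rewrite /btw (ltnW (ltl _ xl)) (ltnW (ltr _ yr)).
- by constructor 1; rewrite xk eqxx yl.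
- by case: xy; rewrite xk yk.
- by constructor 1; rewrite xk eqxx yr orbT.
- constructor 3; exists k; first by rewrite eqxx xr yl !orbT.
  by rewrite /btw (ltnW (ltl _ yl)) (ltnW (ltr _ xr)) orbT.
- by constructor 2; rewrite yk eqxx xr orbT.
- have [->|->|[z /andP[zx zy] b]] := IHr sr xr yr xy; rewrite ?orbT.
  + by constructor 1. + by constructor 2.
  by constructor 3; exists z; rewrite // zx zy !orbT.
Qed.

(** [k] is the last place before [j] where the label changes. As there are only two labels, the
    label before that change is the one at [i]. *)
Lemma boundary_between s p i j :
  i < j < size s -> p (nth 0 s i) != p (nth 0 s j) ->
  exists k, [/\ i <= k < j, p (nth 0 s k) = p (nth 0 s i),
    p (nth 0 s k.+1) = p (nth 0 s j), nth 0 s k \in boundaries s p &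
    nth 0 s k.+1 \in boundaries s p].
Proof.
move=> /andP[]; elim: j i => // j IH i ij js ne.
have [e|ne'] := eqVneq (p (nth 0 s j)) (p (nth 0 s j.+1)).
  have ij' : i < j.
    by rewrite ltn_neqAle -ltnS ij andbT; apply: contra ne => /eqP->; rewrite e.
  have [|k [/andP[ik kj] e1 e2 b1 b2]] := IH i ij' (ltnW js); first by rewrite e.
  by exists k; rewrite ik ltnW // e1 e2.
have ei : p (nth 0 s j) = p (nth 0 s i).
  by move: ne ne'; case: (p _); case: (p _); case: (p _).
exists j; rewrite ltnS in ij; split=> //; first by rewrite ij ltnSn.
- apply: map_f; rewrite mem_filter mem_iota add0n (ltnW js) andbT.
  by rewrite [p (nth 0 s j.+1) == _]eq_sym ne' !orbT.
- by apply: map_f; rewrite mem_filter mem_iota add0n js /= ne' !orbT.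
Qed.

(** * Histories of merges *)

(** Columns are compared through [pos]: the identity for mergesort, the position in the input for
    partition sort. *)
Definition in_rect (pos : nat -> nat) (p q r : nat * nat) :=
  btw (pos p.1) (pos r.1) (pos q.1) && btw p.2 r.2 q.2.

Definition third pos (P : seq (nat * nat)) p q :=
  exists r, [/\ r \in P, r <> p, r <> q & in_rect pos p q r].

Lemma third_sym pos P p q : third pos P p q -> third pos P q p.
Proof.
move=> [r [rP rp rq b]]; exists r; split=> //.
by move: b; rewrite /in_rect /btw => /andP[]; rewrite orbC => -> ; rewrite orbC => ->.
Qed.

Lemma third_sub pos (P P' : seq (nat * nat)) p q :
  {subset P <= P'} -> third pos P p q -> third pos P' p q.
Proof. by move=> sub [r [rP rp rq b]]; exists r; split=> //; apply: sub. Qed.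

(* [T] has been built from the elements with rows in [a, b), and [P] collects
   their touches.  [hist_anc] makes the invariant inductive: it says how [P] meets
   a later touch of an ancestor in one of the two extreme rows. *)
Record history (pos row : nat -> nat) (a b : nat) (T : tree) (P : seq (nat * nat)) :
    Prop := History {
  hist_lt : a < b;
  hist_dom : forall p, p \in P -> (p.1 \in inorder T) && (a <= p.2 < b);
  hist_row : forall x, x \in inorder T -> (x, row x) \in P;
  hist_sat : forall p q, p \in P -> q \in P -> p.1 <> q.1 -> p.2 <> q.2 -> third pos P p q;
  hist_anc : forall p x r, p \in P -> anc T x p.1 -> r = a \/ r = b.-1 ->
    exists z, [/\ z \in P, z <> p, p.2 <> r -> z <> (x, r) & in_rect pos p (x, r) z] }.

Lemma history_leaf pos row x :
  history pos row (row x) (row x).+1 (Node Leaf x Leaf) [:: (x, row x)].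
Proof.
split=> //=.
- by move=> p; rewrite !inE => /eqP-> /=; rewrite eqxx leqnn ltnSn.
- by move=> y; rewrite inE => /eqP->; rewrite mem_head.
- by move=> p q; rewrite !inE => /eqP-> /eqP->.
- by move=> p y r _; rewrite andbF.
Qed.

(** [r'] is the extreme row of [a, b) on the side of [r], hence lies between [t] and [r]. *)
Lemma btw_outside a b t r r' :
  a <= t < b -> r <= r' /\ r' = a \/ r' <= r /\ r' = b.-1 -> t <> r -> r' <> r ->
  ~ btw t r r'.
Proof. rewrite /btw; lia. Qed.

Lemma btw_widen a b t r r' s :
  a <= t < b -> r <= r' /\ r' = a \/ r' <= r /\ r' = b.-1 -> btw t s r' -> btw t s r.
Proof. rewrite /btw; lia. Qed.

Lemma btwl x y : btw x x y. Proof. rewrite /btw; lia. Qed.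
Lemma btwr x y : btw x y y. Proof. rewrite /btw; lia. Qed.

(* Both inputs of a merge play the same role, so the two ways of meeting the
   touched rows are proved once, for an input [TA] with the other one [TB]. *)
Section OneInput.
Variables (pos row : nat -> nat) (a b : nat) (TA TB T : tree).
Variables (PA P : seq (nat * nat)) (tau taua R : seq nat).
Hypotheses (histA : history pos row a b TA PA)
  (uniqT : uniq (inorder T))
  (sortA : sorted (relpre pos ltn) (inorder TA))
  (subP : {subset PA <= P})
  (rowsP : forall x r, x \in tau -> r \in R -> (x, r) \in P)
  (outR : forall r, r \in R -> r <= a \/ b.-1 <= r)
  (topA : top_below taua TA)
  (tauaT : {subset taua <= tau})
  (tauA : forall x, x \in tau -> x \in inorder TA -> x \in taua)
  (topT : top_below tau T)
  (hangA : forall x y, anc T x y -> x \notin tau -> y \in inorder TA -> anc TA x y)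
  (coverT : forall x, x \in inorder T -> (x \in inorder TA) || (x \in inorder TB))
  (blocks : forall x y, x \in inorder TA -> y \in inorder TB ->
     exists e f, [/\ e \in inorder TA, f \in inorder TB, e \in tau, f \in tau &
                     btw (pos x) (pos e) (pos y) && btw (pos x) (pos f) (pos y)])
  (disjAB : forall x, x \in inorder TA -> x \in inorder TB -> False).

(** Replace [r] by the extreme row [r'] of [a, b) on its side and use [hist_anc] there: the
    rectangle to [(x, r')] lies inside the one to [(x, r)] and misses [(x, r)] when the rows
    differ. *)
Lemma input_anc (p : nat * nat) (x r : nat) :
  p \in PA -> anc TA x p.1 -> r \in R ->
  exists z, [/\ z \in P, z <> p, p.2 <> r -> z <> (x, r) & in_rect pos p (x, r) z].
Proof.
move=> pA xp rR; have /andP[_ prow] := hist_dom histA pA.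
have [r' [r'e r'r]] : exists r', (r' = a \/ r' = b.-1) /\
    (r <= r' /\ r' = a \/ r' <= r /\ r' = b.-1).
  by case: (outR rR) => ?; [exists a | exists b.-1]; tauto.
have [z [zA zp zx /andP[b1 b2]]] := hist_anc histA pA xp r'e.
exists z; split=> //; first exact: subP.
  move=> pr ez; have [e|/eqP ne] := eqVneq r' r.
    by apply: zx; rewrite e.
  by rewrite ez /= in b2; apply: (btw_outside prow r'r pr ne).
by rewrite /in_rect b1 /=; apply: btw_widen prow r'r b2.
Qed.

(** A touched key other than [x], between [p.1] and [x], gives a third point in row [r]. If [x]
    comes from [TB], a block boundary is such a key; if [p.1] is touched, it is one itself.
    Otherwise [x] or the lowest common ancestor is a touched ancestor of [p.1]; when it is [x],
    [input_anc] applies. *)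
Lemma input_third (p : nat * nat) (x r : nat) :
  p \in PA -> x \in tau -> x \in inorder T -> r \in R -> p.1 <> x -> p.2 <> r ->
  third pos P p (x, r).
Proof.
move=> pA xt xT rR px pr; have /andP[pTA _] := hist_dom histA pA.
have corner y : y \in tau -> y <> x -> btw (pos p.1) (pos y) (pos x) ->
    third pos P p (x, r).
  move=> yt yx by_; exists (y, r); split.
  - exact: rowsP.
  - by move=> e; apply: pr; rewrite -e.
  - by case.
  - by rewrite /in_rect by_ /= btwr.
have /orP[xA|xB] := coverT xT; last first.
  have [e [f [eA _ et _ /andP[be _]]]] := blocks pTA xB.
  by apply: corner et _ be => ex; apply: (disjAB eA); rewrite ex.
have [pt|pt] := boolP (p.1 \in tau); first exact: corner pt px (btwl _ _).
have xta := tauA xt xA.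
suff [y [yt yp yb]] : exists y, [/\ y \in taua, anc TA y p.1 &
    btw (pos p.1) (pos y) (pos x)].
  have [yx|/eqP yx] := eqVneq y x; last exact: corner (tauaT yt) yx yb.
  rewrite yx in yp; have [z [zP zp zx bz]] := input_anc pA yp rR.
  by exists z; split=> //; apply: zx.
have [px'|xp|[z /andP[zp zx] bz]] := common_anc sortA pTA xA px.
- by rewrite (tauaT (top_anc topA px' xta)) in pt.
- by exists x; split=> //; apply: btwr.
- by exists z; split=> //; apply: top_anc topA zx xta.
Qed.

(** An untouched [x] lies in an unchanged hanging subtree, so it was an ancestor of [p.1] already in
    [TA]. A touched [x] is handled by [input_third], or by [(x, r)] itself when [p] is in row
    [r]. *)
Lemma input_hist_anc (p : nat * nat) (x r : nat) :
  p \in PA -> anc T x p.1 -> r \in R ->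
  exists z, [/\ z \in P, z <> p, p.2 <> r -> z <> (x, r) & in_rect pos p (x, r) z].
Proof.
move=> pA xp rR; have /andP[pTA _] := hist_dom histA pA.
have [xT _] := andP (anc_inorder xp).
have [xt|xt] := boolP (x \in tau); last first.
  by apply: input_anc => //; apply: hangA.
have px := anc_neq uniqT xp.
have [er|/eqP pr] := eqVneq p.2 r; last first.
  have [z [zP zp zx bz]] := input_third pA xt xT rR (nesym px) pr.
  by exists z.
exists (x, r); split=> //.
- exact: rowsP.
- by move=> e; apply: px; rewrite -e.
- by rewrite /in_rect !btwr.
Qed.

End OneInput.

(** The common form of a BST merge and of a BT partition read backwards; [pos] supplies the
    left-to-right order of the trees. *)
Definition tree_merge (pos : nat -> nat) (TA TB T : tree) (cost : nat) : Prop :=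
  [/\ sorted (relpre pos ltn) (inorder TA), sorted (relpre pos ltn) (inorder TB),
      sorted (relpre pos ltn) (inorder T),
      perm_eq (inorder T) (inorder TA ++ inorder TB) &
  exists tau taua taub : seq nat,
    is_top tau T /\ is_top taua TA /\ is_top taub TB /\
    perm_eq tau (taua ++ taub) /\
    (forall t, List.In t (hang tau T) ->
               List.In t (subtrees TA) \/ List.In t (subtrees TB)) /\
    all (fun x => x \in tau) (boundaries (inorder T) (fun x => x \in inorder TA)) /\
    cost = size tau].

Lemma sorted_pos_uniq pos (s : seq nat) : sorted (relpre pos ltn) s -> uniq s.
Proof.
apply: sorted_uniq => [y x z|x]; first exact: ltn_trans.
by rewrite /= ltnn.
Qed.

Lemma sorted_pos_le pos (s : seq nat) i j :
  sorted (relpre pos ltn) s -> i <= j < size s -> pos (nth 0 s i) <= pos (nth 0 s j).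
Proof.
move=> ss /andP[ij js]; case: (ltngtP i j) ij => // [ij _|-> //]; apply: ltnW.
have tr : transitive (relpre pos ltn) by move=> y x z; apply: ltn_trans.
by apply: (sorted_ltn_nth tr 0 ss) => //; rewrite inE // (ltn_trans ij).
Qed.

Lemma blocks_touched pos (T : tree) (p : pred nat) (tau : seq nat) x y :
  sorted (relpre pos ltn) (inorder T) ->
  all (fun z => z \in tau) (boundaries (inorder T) p) ->
  x \in inorder T -> y \in inorder T -> p x != p y ->
  exists e f, [/\ p e = p x, p f = p y, e \in tau, f \in tau &
    btw (pos x) (pos e) (pos y) && btw (pos x) (pos f) (pos y)].
Proof.
move=> sT /allP bT; set s := inorder T in sT bT *.
move=> /(nthP 0)[i iS <-] /(nthP 0)[j jS <-] ne.
have mono u v : u <= v -> v < size s -> pos (nth 0 s u) <= pos (nth 0 s v).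
  by move=> uv vs; apply: sorted_pos_le; rewrite // uv.
case: (ltngtP i j) => ij; last by rewrite ij eqxx in ne.
- have [|k [/andP[ik kj] e1 e2 b1 b2]] := @boundary_between s p i j _ ne.
    by rewrite ij.
  exists (nth 0 s k), (nth 0 s k.+1); split=> //; try exact: bT.
  have le := (mono i k ik (ltn_trans kj jS), mono k j (ltnW kj) jS,
    mono i k.+1 (leqW ik) (leq_ltn_trans kj jS), mono k.+1 j kj jS).
  by rewrite /btw !le.
- have [||k [/andP[ik kj] e1 e2 b1 b2]] := @boundary_between s p j i.
  + by rewrite ij.
  + by rewrite eq_sym.
  exists (nth 0 s k.+1), (nth 0 s k); split=> //; try exact: bT.
  have le := (mono j k ik (ltn_trans kj iS), mono k i (ltnW kj) iS,
    mono j k.+1 (leqW ik) (leq_ltn_trans kj iS), mono k.+1 i kj iS).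
  by rewrite /btw !le !orbT.
Qed.

Lemma top_mem S T : is_top S T -> {subset S <= inorder T}.
Proof. by case/and4P=> _ _ _ /allP. Qed.

Lemma top_size S T : is_top S T -> 0 < size S.
Proof. by case/and4P=> rS _ _ _; case: T rS => // l k r /=; case: S. Qed.

(** Pairs within one input are satisfied by induction, an old and a new point by [input_third],
    points of different inputs by block boundaries touched in row [m.-1], and two new points by the
    grid of [tau] and [R]. *)
Lemma merge_history pos row a m b TA TB T PA PB c :
  history pos row a m TA PA -> history pos row m b TB PB -> tree_merge pos TA TB T c ->
  exists P, history pos row a b T P /\ size P = size PA + size PB + 4 * c.
Proof.
move=> hA hB [sA sB sT pT [tau [taua [taub [topT [topA [topB [ptau [hng [bnd ->]]]]]]]]]].
(* The extreme rows of both intervals; for either interval, each is extreme or outside. Rows may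
   coincide, and [P] then repeats points, so its size grows by exactly four per access. *)
pose R := [:: a; m.-1; m; b.-1].
exists (PA ++ PB ++ [seq (x, r) | x <- tau, r <- R]); last first.
  split; last by rewrite !size_cat size_allpairs mulnC addnA.
set P := PA ++ _.
have am := hist_lt hA; have mb := hist_lt hB.
have uT := sorted_pos_uniq sT.
have uAB : uniq (inorder TA ++ inorder TB) by rewrite -(perm_uniq pT).
have memT x : (x \in inorder T) = (x \in inorder TA) || (x \in inorder TB).
  by rewrite (perm_mem pT) mem_cat.
have memtau x : (x \in tau) = (x \in taua) || (x \in taub).
  by rewrite (perm_mem ptau) mem_cat.
have disj x : x \in inorder TA -> x \in inorder TB -> False.
  by move: uAB; rewrite cat_uniq => /and3P[_ /hasPn h _] xA /h; rewrite xA.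
have subA : {subset PA <= P} by move=> p pA; rewrite mem_cat pA.
have subB : {subset PB <= P} by move=> p pB; rewrite !mem_cat pB orbT.
have rowsP x r : x \in tau -> r \in R -> (x, r) \in P.
  by move=> xt rR; rewrite !mem_cat allpairs_f ?orbT.
have outA r : r \in R -> r <= a \/ m.-1 <= r.
  by rewrite !inE => /or4P[]/eqP->; clear -am mb; lia.
have outB r : r \in R -> r <= m \/ b.-1 <= r.
  by rewrite !inE => /or4P[]/eqP->; clear -am mb; lia.
have [/and4P[_ tbT _ _] /and4P[_ tbA _ _] /and4P[_ tbB _ _]] := And3 topT topA topB.
have ttA x : x \in tau -> x \in inorder TA -> x \in taua.
  by rewrite memtau => /orP[//|/(top_mem topB) xB xA]; case: (disj x).
have ttB x : x \in tau -> x \in inorder TB -> x \in taub.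
  by rewrite memtau => /orP[/(top_mem topA) xA xB|//]; case: (disj x).
have tauA x : x \in taua -> x \in tau by rewrite memtau => ->.
have tauB x : x \in taub -> x \in tau by rewrite memtau orbC => ->.
have hangA x y : anc T x y -> x \notin tau -> y \in inorder TA -> anc TA x y.
  move=> xy xt yA; have [h /hng[hA'|hB'] hxy] := hang_anc xy xt.
    exact: subtrees_anc hA' hxy.
  by have /andP[_ /(disj y yA)] := anc_inorder (subtrees_anc hB' hxy).
have hangB x y : anc T x y -> x \notin tau -> y \in inorder TB -> anc TB x y.
  move=> xy xt yB; have [h /hng[hA'|hB'] hxy] := hang_anc xy xt.
    by have /andP[_ /disj/(_ yB)] := anc_inorder (subtrees_anc hA' hxy).
  exact: subtrees_anc hB' hxy.
have blk x y : x \in inorder TA -> y \in inorder TB ->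
  exists e f, [/\ e \in inorder TA, f \in inorder TB, e \in tau, f \in tau &
    btw (pos x) (pos e) (pos y) && btw (pos x) (pos f) (pos y)].
  move=> xA yB; have yA : (y \in inorder TA) = false.
    by apply/negP => /disj; apply.
  have [|||e [f [eA fB et ft bef]]] :=
      @blocks_touched pos T (fun z => z \in inorder TA) tau x y sT bnd.
  - by rewrite memT xA.
  - by rewrite memT yB orbT.
  - by rewrite xA yA.
  rewrite xA in eA; exists e, f; split=> //.
  have : f \in inorder T by apply: top_mem topT _ ft.
  by rewrite memT fB yA.
have blk' y x : y \in inorder TB -> x \in inorder TA ->
  exists e f, [/\ e \in inorder TB, f \in inorder TA, e \in tau, f \in tau &
    btw (pos y) (pos e) (pos x) && btw (pos y) (pos f) (pos x)].
  move=> yB xA; have [e [f [eA fB et ft bef]]] := blk x y xA yB.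
  exists f, e; split=> //; move: bef; rewrite /btw; clear; lia.
have coverA x : x \in inorder T -> (x \in inorder TA) || (x \in inorder TB).
  by rewrite memT.
have coverB x : x \in inorder T -> (x \in inorder TB) || (x \in inorder TA).
  by rewrite memT orbC.
have thirdA := input_third hA sA subA rowsP outA tbA tauA ttA
  coverA blk disj.
have thirdB := input_third hB sB subB rowsP outB tbB tauB ttB
  coverB blk' (fun x xB xA => disj x xA xB).
have memP p : p \in P -> [\/ p \in PA, p \in PB |
    exists x r, [/\ p = (x, r), x \in tau, r \in R & x \in inorder T]].
  rewrite !mem_cat => /or3P[pA|pB|/allpairsP[[x r] /= [xt rR ->]]].
  - by constructor 1.
  - by constructor 2.
  by constructor 3; exists x, r; split=> //; apply: top_mem topT _ xt.
have rR : [/\ a \in R, m.-1 \in R & b.-1 \in R] by rewrite !inE !eqxx !orbT.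
have [aR mR bR] := rR.
have cross p q : p \in PA -> q \in PB -> p.1 <> q.1 -> p.2 <> q.2 -> third pos P p q.
  move=> pA qB pq1 pq2; have /andP[pTA prow] := hist_dom hA pA.
  have /andP[qTB qrow] := hist_dom hB qB.
  have [e [f [eA fB et ft /andP[be bf]]]] := blk _ _ pTA qTB.
  have bm : btw p.2 m.-1 q.2.
    by move: prow qrow; move: p.2 q.2; clear; rewrite /btw; lia.
  (* The boundary [e] on the side of [p] serves unless its point is [p]; then the boundary [f] on
     the side of [q] does. *)
  have [pe|pe] := eqVneq p (e, m.-1).
    exists (f, m.-1); split; first exact: rowsP.
    - by rewrite pe => -[ef]; apply: (disj e); rewrite // -ef.
    - by move=> eq; apply: pq2; rewrite pe -eq.
    by rewrite /in_rect bf.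
  exists (e, m.-1); split; first exact: rowsP.
  - by apply/nesym/eqP.
  - by move=> eq; apply: (disj e); rewrite // -[e]/((e, m.-1).1) eq.
  by rewrite /in_rect be.
split.
- exact: ltn_trans am mb.
- move=> p /memP[pA|pB|[x [r [-> _ rR' xT]]]].
  + by have /andP[pT' /andP[l1 l2]] := hist_dom hA pA; rewrite memT pT' l1 (ltn_trans l2).
  + have /andP[pT' /andP[l1 l2]] := hist_dom hB pB.
    by rewrite memT pT' orbT l2 (leq_trans (ltnW am)).
  rewrite xT /=; clear -rR' am mb; move: rR'; rewrite !inE.
  by case/or4P=> /eqP->; lia.
- by move=> x; rewrite memT => /orP[/(hist_row hA)/subA|/(hist_row hB)/subB].
- move=> p q /memP[pA|pB|[x [r [-> xt xr xT]]]] /memP[qA|qB|[y [s [-> yt ys yT]]]] pq1 pq2.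
  + exact: third_sub subA (hist_sat hA pA qA pq1 pq2).
  + exact: cross.
  + exact: thirdA.
  + by apply: third_sym; apply: cross => //; apply: nesym.
  + exact: third_sub subB (hist_sat hB pB qB pq1 pq2).
  + exact: thirdB.
  + by apply: third_sym; apply: thirdA => //; apply: nesym.
  + by apply: third_sym; apply: thirdB => //; apply: nesym.
  + exists (x, s); split; first exact: rowsP.
    * by case=> e; apply: pq2.
    * by case=> e; apply: pq1.
    by rewrite /in_rect /= btwl btwr.
- have inR r : r = a \/ r = b.-1 -> r \in R by case=> ->.
  move=> p x r /memP[pA|pB|[y [s [-> yt sR yT]]]] xp /inR {}rR.
  + exact: (input_hist_anc hA uT sA subA rowsP outA tbA tauA ttA
              hangA coverA blk disj).
  + exact: (input_hist_anc hB uT sB subB rowsP outB tbB tauB ttB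
              hangB coverB blk' (fun x xB xA => disj x xA xB)).
  (* Here the descendant [y] is touched by this merge, so its ancestor [x] is too, and a corner of
     the rectangle serves. *)
  have xy : x <> y := anc_neq uT xp.
  have xt : x \in tau := top_anc tbT xp yt.
  have [sr|/eqP sr] := eqVneq s r.
    exists (x, r); split=> //; first exact: rowsP.
      by case.
    by rewrite /in_rect !btwr.
  exists (y, r); split; first exact: rowsP.
  - by case=> e; apply: sr.
  - by move=> _ [e]; apply: xy.
  by rewrite /in_rect /= btwl btwr.
Qed.

(** * Mergesort and partition sort *)

Lemma tree_merge_cost pos TA TB T c : tree_merge pos TA TB T c -> 0 < c.
Proof.
case=> _ _ _ _ [tau [taua [taub [_ [topA [_ [ptau [_ [_ ->]]]]]]]]].
by rewrite (perm_size ptau) size_cat addn_gt0 (top_size topA).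
Qed.

Lemma bst_merge_tree_merge TA TB T c : bst_merge TA TB T c -> tree_merge id TA TB T c.
Proof.
move=> [sA [sB [_ [sT [pT [tau [taua [taub [tT [tA [tB [ptau [hng [bnd e]]]]]]]]]]]]]].
split=> //; exists tau, taua, taub; do !split=> //.
suff <- : sort leq (inorder TA ++ inorder TB) = inorder T by [].
apply: (sorted_eq leq_trans anti_leq).
- by apply: sort_sorted; exact: leq_total.
- by apply: sub_sorted sT => x y; exact: ltnW.
- by rewrite perm_sort perm_sym.
Qed.

Lemma ms_run_perm s T c : ms_run s T c -> perm_eq (inorder T) s.
Proof.
elim=> // s1 s2 T1 T2 {}T c1 c2 {}c _ _ _ p1 _ p2 [_ [_ [_ [_ [pT _]]]]].
exact: perm_trans pT (perm_cat p1 p2).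
Qed.

(** Each leaf gives one point and each access four. Every merge has at least one access, and there
    is one leaf more than merges, whence [5 * c + 1]. *)
Lemma ms_history s T c row a :
  ms_run s T c -> (forall i, i < size s -> row (nth 0 s i) = a + i) ->
  exists P, history id row a (a + size s) T P /\ size P <= 5 * c + 1.
Proof.
move=> run; elim: run a => [x|s1 s2 T1 T2 {}T c1 c2 {}c _ _ _ IH1 _ IH2 mrg] a rowE.
  have := rowE 0 isT; rewrite addn0 /= => <-.
  by exists [:: (x, row x)]; rewrite addn1; split=> //; apply: history_leaf.
have [|P1 [h1 sz1]] := IH1 a.
  move=> i lt; have := rowE i; rewrite nth_cat size_cat lt; apply.
  exact: ltn_addr.
have [|P2 [h2 sz2]] := IH2 (a + size s1).
  move=> i lt; have := rowE (size s1 + i).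
  rewrite nth_cat size_cat ltn_add2l lt ltnNge leq_addr addKn addnA; exact.
have mrg' := bst_merge_tree_merge mrg; have c_gt0 := tree_merge_cost mrg'.
have [P [h sz]] := merge_history h1 h2 mrg'.
exists P; rewrite size_cat addnA; split=> //; rewrite sz.
clear -sz1 sz2 c_gt0; lia.
Qed.

(** The pivot cuts an interval of keys into two adjacent intervals, which become the row intervals
    [a, m) and [m, b) of a merge. *)
Lemma split_iota A B a k :
  perm_eq (A ++ B) (iota a (size A + size B)) ->
  all (fun x => x < k) A -> all (fun x => k <= x) B ->
  perm_eq A (iota a (size A)) /\ perm_eq B (iota (a + size A) (size B)).
Proof.
move=> pAB /allP ltA /allP geB.
have : sort leq A ++ sort leq B = iota a (size A) ++ iota (a + size A) (size B).
  rewrite -iotaD; apply: (sorted_eq leq_trans anti_leq).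
  - rewrite (sorted_pairwise leq_trans) pairwise_cat -!(sorted_pairwise leq_trans).
    rewrite !sort_sorted ?andbT; try exact: leq_total.
    apply/allrelP => x y; rewrite !mem_sort => /ltA xk /geB; exact/leq_trans/ltnW.
  - exact: iota_sorted.
  - by apply: perm_trans pAB; rewrite perm_cat // perm_sort.
move/eqP; rewrite eqseq_cat ?size_sort ?size_iota // => /andP[/eqP <- /eqP <-].
by rewrite ![perm_eq _ (sort _ _)]perm_sym !perm_sort.
Qed.

Lemma bt_partition_tree_merge pos T TA TB c :
  sorted (relpre pos ltn) (inorder T) -> bt_partition T TA TB c ->
  tree_merge pos TA TB T c.
Proof.
have tr : transitive (relpre pos ltn) by move=> y x z; apply: ltn_trans.
by move=> sT [_ [_ [_ [pT [sbA [sbB ex]]]]]]; split=> //; apply: subseq_sorted sT.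
Qed.

Lemma ps_history T c pos a :
  ps_run T c -> sorted (relpre pos ltn) (inorder T) ->
  perm_eq (inorder T) (iota a (size (inorder T))) ->
  exists P, history pos id a (a + size (inorder T)) T P /\ size P <= 5 * c + 1.
Proof.
move=> run; elim: run a => [x|{}T TA TB k {}c ca cb prt ltA geB _ IHA _ IHB] a sT pT.
  have <- : x = a by have := perm_mem pT x; rewrite !inE eqxx => /esym/eqP.
  by exists [:: (x, x)]; rewrite /= addn1; split=> //; apply: (history_leaf pos id).
have mrg := bt_partition_tree_merge sT prt; have c_gt0 := tree_merge_cost mrg.
have [sA sB _ pAB _] := mrg.
have szT : size (inorder T) = size (inorder TA) + size (inorder TB).
  by rewrite (perm_size pAB) size_cat.
have [|pA pB] := split_iota _ ltA geB (a := a).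
  by rewrite -szT; apply: perm_trans pT; rewrite perm_sym.
have [PA [hA szA]] := IHA a sA pA; have [PB [hB szB]] := IHB _ sB pB.
have [P [h sz]] := merge_history hA hB mrg.
exists P; rewrite szT addnA; split=> //; rewrite sz.
clear -szA szB c_gt0; lia.
Qed.

Theorem theorem1 :
  exists K : nat, forall (n : nat) (pi : seq nat),
    perm_eq pi (iota 1 n) ->
    (forall (T : tree) (c : nat), ms_run pi T c -> OPT_BST_le pi (K * c.+1)) /\
    (forall (T0 : tree) (c : nat), inorder T0 = pi -> ps_run T0 c ->
        OPT_BST_le pi (K * c.+1)).
Proof.
(* Ten steps per point and at most [5 * c + 1] points. *)
exists 50 => n pi pin.
have upi : uniq pi by rewrite (perm_uniq pin) iota_uniq.
have szpi : size pi = n by rewrite (perm_size pin) size_iota.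
have opt_le (Q : seq (nat * nat)) c : size Q <= 5 * c + 1 -> OPT_BST_le pi (10 * size Q) ->
    OPT_BST_le pi (50 * c.+1).
  move=> szQ [T0 [c0 [inT0 [run le]]]]; exists T0, c0; do !split=> //.
  by apply: leq_trans le _; clear -szQ; lia.
split=> [T c run|T c inT run].
  have [|P [h szP]] := ms_history (row := index^~ pi) (a := 0) run.
    by move=> i lt; rewrite index_uniq.
  apply: opt_le szP _; apply: satisfied_serve pin _ => [p q pP qP ne1 ne2|t tn].
    have [r [rP rp rq /andP[b1 b2]]] := hist_sat h pP qP ne1 ne2.
    by exists r.
  rewrite -szpi in tn; have := hist_row h (x := nth 0 pi t).
  by rewrite (perm_mem (ms_run_perm run)) mem_nth // index_uniq //; apply.
have [||P [h szP]] := @ps_history T c (index^~ pi) 1 run.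
- rewrite inT; apply/(sortedP 0) => i lt /=.
  by rewrite !index_uniq // ltnW.
- by rewrite inT szpi.
(* Exchanging the two axes turns the history of the partition sort, whose rows
   are keys and whose columns are positions, into a set of touched keys. *)
pose Q := [seq (p.2, index p.1 pi) | p <- P].
have szQ : size Q <= 5 * c + 1 by rewrite size_map.
apply: opt_le szQ _; apply: satisfied_serve pin _ => [p q|t tn].
  (* Distinct points stay distinct after the exchange: [index] is injective on the members of [pi],
     and [hist_dom] keeps the columns among them. *)
  have inj (x y : nat * nat) : x \in P -> y \in P ->
      x.2 = y.2 -> index x.1 pi = index y.1 pi -> x = y.
    move=> xP yP e2 e1; have /andP[xT _] := hist_dom h xP.
    have /andP[yT _] := hist_dom h yP; rewrite inT in xT yT.
    rewrite [x]surjective_pairing [y]surjective_pairing e2.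
    by rewrite -(nth_index 0 xT) e1 nth_index.
  move=> /mapP[p' pP ->] /mapP[q' qP ->] /= ne1 ne2.
  have [|//|r [rP rp rq /andP[b1 b2]]] := hist_sat h pP qP.
    by move=> e; apply: ne2; rewrite e.
  exists (r.2, index r.1 pi); split=> //; first exact: map_f.
    by case=> e2 e1; apply: rp; apply: inj.
  by case=> e2 e1; apply: rq; apply: inj.
(* With [id] as row function each key is touched in the row of its own value; exchanged, this is the
   access of that key at time [t]. *)
apply/mapP; exists (nth 0 pi t, nth 0 pi t); last by rewrite /= index_uniq ?szpi.
by apply: (hist_row h); rewrite inT mem_nth ?szpi.
Qed.
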